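(* Let $t>0$ and let $\lambda_0^t:\Omega\to\mathbb{R}$ be the largest eigenvalue of the Cauchy-Green deformation tensor of the flow from time $0$ to time $t$. Suppose $\lambda_0^t$ is continuous everywhere in the spatial domain $\Omega$, and let $\mathcal{M}$ be a $\lambda_0^t$-ridge with $m=\min_{\mathbf{x}\in\mathcal{M}}\sqrt{\lambda_0^t(\mathbf{x})}>0$. Then for every separation factor $r>1$ with $r\in(0,m)$, there is a tubular neighbourhood $\Gamma_{\mathcal{M}}(\rho)$ of $\mathcal{M}$, for some $\rho>0$, such that the infinitesimal size Lyapunov exponent (ISLE) function satisfies $\gamma_r(\mathbf{y},0)>0$ for all $\mathbf{y}\in\Gamma_{\mathcal{M}}(\rho)$.
   Context: Flow. Let $\Omega\subset\mathbb{R}^d$ be a bounded domain and $\mathbf{u}:\Omega\times\mathbb{R}\to\mathbb{R}^d$ a (time dependent) Lipschitz velocity field. Consider the ODE $\mathbf{x}'(t)=\mathbf{u}(\mathbf{x}(t),t)$. The flow map $\Phi_a^b$ sends $\mathbf{x}_0\in\Omega$ to $\Phi_a^b(\mathbf{x}_0)=\mathbf{x}(b)$, where $\mathbf{x}$ is the solution with $\mathbf{x}(a)=\mathbf{x}_0$. Solutions are taken to exist for all initial points in $\Omega$ and all times considered, and each $\Phi_a^b$ is taken to be differentiable in the spatial variable, so that its Jacobian is defined. Cauchy-Green tensor. $C_0^\tau(\mathbf{x})=[\nabla\Phi_0^\tau(\mathbf{x})]^*\,\nabla\Phi_0^\tau(\mathbf{x})$ (where $^*$ is the transpose), and $\lambda_0^\tau(\mathbf{x})=\lambda_{\max}(C_0^\tau(\mathbf{x}))$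 is its largest eigenvalue. ISLE. For a separation factor $r>1$ and the time window $[0,t]$, if $\sqrt{\lambda_0^\tau(\mathbf{x})}=r$ for some $\tau\in[0,t]$, let $\tau_r(\mathbf{x})$ be the shortest such time and set $\gamma_r(\mathbf{x},0)=\frac{\ln r}{|\tau_r(\mathbf{x})|}$. By convention $\gamma_r(\mathbf{x},0)=0$ if $\sqrt{\lambda_0^s(\mathbf{x})}<r$ for all $s\in[0,t]$. Ridge. For a scalar function $f$ on $\Omega$, an $f$-ridge is a codimension-one, compact, $C^1$ surface (possibly with boundary) $\mathcal{M}\subset\Omega$ such that for every $\mathbf{x}\in\mathcal{M}$, $f(\mathbf{x})$ is a local maximum of $f$ along the normal direction to $\mathcal{M}$ at $\mathbf{x}$; that is, with $\mathbf{n}_{\mathbf{x}}$ a unit normal to $\mathcal{M}$ at $\mathbf{x}$, there is $\delta>0$ such that $f(\mathbf{x}+s\,\mathbf{n}_{\mathbf{x}})\le f(\mathbf{x})$ for all $|s|<\delta$. Tubular neighbourhood. For a codimension-one, compact, smooth surface $\mathcal{S}$ and $\rho>0$, $\Gamma_{\mathcal{S}}(\rho)$ is the collection of points $\mathbf{y}$ that can be uniquely expressed as $\mathbf{y}=\mathbf{x}+s\,\mathbf{n}_{\mathbf{x}}$ with $\mathbf{x}\in\mathcal{S}$, $s\in(-\rho,\rho)$ and $\mathbf{n}_{\mathbf{x}}$ a unit normal vector of $\mathcal{S}$ at $\mathbf{x}$ (uniqueness up to replacing $(s,\mathbf{n}_{\mathbf{x}})$ by $(-s,-\mathbf{n}_{\mathbf{x}})$).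 It is understood that $\rho$ is small enough that every point $\mathbf{x}+s\,\mathbf{n}_{\mathbf{x}}$ with $\mathbf{x}\in\mathcal{S}$, $|s|<\rho$, lies in $\Omega$ and has such a unique expression. Whenever a tubular neighbourhood of a ridge is considered, the ridge is assumed to be smooth, as this definition requires. *)

(* Defs.v *)
From mathcomp Require Import all_boot all_order all_algebra.
From mathcomp Require Import all_classical all_reals all_analysis.

Set Implicit Arguments.
Unset Strict Implicit.
Unset Printing Implicit Defensive.

Import Order.TTheory GRing.Theory Num.Theory.
Import numFieldNormedType.Exports.

Local Open Scope classical_set_scope.
Local Open Scope ring_scope.

(* R^d is 'rV[R]_d. The library norm on it is the sup norm, equivalent to the
   Euclidean one; wherever the Euclidean structure matters (unit normals,
   orthogonality) [dotr] is used instead. *)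
Definition dotr (R : realType) (d : nat) (v w : 'rV[R]_d) : R :=
  \sum_(i < d) v 0 i * w 0 i.

Definition minimum_of (R : realType) (A : set R) (m : R) : Prop :=
  A m /\ lbound A m.

Definition bounded_domain (R : realType) (d : nat) (Omega : set 'rV[R]_d) :
    Prop :=
  [/\ Omega !=set0, open Omega, connected Omega & bounded_set Omega].

(* Only the values of u on Omega * R matter. The Lipschitz constant in space is
   uniform on bounded sets of times; this is implied by joint Lipschitz
   continuity in (x, s). *)
Definition lipschitz_velocity (R : realType) (d : nat) (Omega : set 'rV[R]_d)
    (u : 'rV[R]_d -> R -> 'rV[R]_d) : Prop :=
  forall T : R, exists L : R,
    forall s : R, `|s| <= T -> L.-lipschitz_Omega (fun x => u x s).

(* Solution of x' = u(x, s), with values in Omega, on the closed interval with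
   endpoints a and b (in either order). *)
Definition solution (R : realType) (d : nat) (Omega : set 'rV[R]_d)
    (u : 'rV[R]_d -> R -> 'rV[R]_d) (a b : R) (x : R -> 'rV[R]_d) : Prop :=
  let lo := Num.min a b in
  let hi := Num.max a b in
  [/\ forall s, s \in `[lo, hi] -> Omega (x s),
      {within `[lo, hi], continuous x} &
      forall s, s \in `]lo, hi[ -> is_derive s 1 x (u (x s) s)].

Definition flow_exists (R : realType) (d : nat) (Omega : set 'rV[R]_d)
    (u : 'rV[R]_d -> R -> 'rV[R]_d) (a b : R) : Prop :=
  forall x0, Omega x0 -> exists2 x, solution Omega u a b x & x a = x0.

(* Phi_a^b; the default value x0 is only used where no solution exists. *)
Definition flow (R : realType) (d : nat) (Omega : set 'rV[R]_d)
    (u : 'rV[R]_d -> R -> 'rV[R]_d) (a b : R) (x0 : 'rV[R]_d) : 'rV[R]_d :=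
  xget x0 [set y | exists x, [/\ solution Omega u a b x, x a = x0 & y = x b]].

(* The library acts on row vectors: 'J f p is the transpose of the usual
   Jacobian matrix (\partial_j f_i). *)
Definition gradient_mx (R : realType) (d : nat) (f : 'rV[R]_d -> 'rV[R]_d)
    (p : 'rV[R]_d) : 'M[R]_d := ('J f p)^T.

Definition cauchy_green (R : realType) (d : nat) (Omega : set 'rV[R]_d)
    (u : 'rV[R]_d -> R -> 'rV[R]_d) (a b : R) (x : 'rV[R]_d) : 'M[R]_d :=
  (gradient_mx (flow Omega u a b) x)^T *m gradient_mx (flow Omega u a b) x.

(* For d > 0 and A symmetric, the set of eigenvalues is finite and nonempty, so
   that its supremum is its largest element. *)
Definition lambda_max (R : realType) (d : nat) (A : 'M[R]_d) : R :=
  sup [set a : R | eigenvalue A a].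

Definition cg_lambda (R : realType) (d : nat) (Omega : set 'rV[R]_d)
    (u : 'rV[R]_d -> R -> 'rV[R]_d) (a b : R) (x : 'rV[R]_d) : R :=
  lambda_max (cauchy_green Omega u a b x).

(* Times in the window [0, t] at which the separation factor is r. *)
Definition separation_times (R : realType) (d : nat) (Omega : set 'rV[R]_d)
    (u : 'rV[R]_d -> R -> 'rV[R]_d) (t r : R) (x : 'rV[R]_d) : set R :=
  [set tau | 0 <= tau <= t /\ Num.sqrt (cg_lambda Omega u 0 tau x) = r].

(* tau_r(x), as an actual minimum. The default is 0 when there is no minimum,
   which makes the quotient defining [isle] equal to 0. *)
Definition separation_time (R : realType) (d : nat) (Omega : set 'rV[R]_d)
    (u : 'rV[R]_d -> R -> 'rV[R]_d) (t r : R) (x : 'rV[R]_d) : R :=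
  xget 0 [set tau | minimum_of (separation_times Omega u t r x) tau].

(* gamma_r(x, 0), for the time window [0, t] *)
Definition isle (R : realType) (d : nat) (Omega : set 'rV[R]_d)
    (u : 'rV[R]_d -> R -> 'rV[R]_d) (t r : R) (x : 'rV[R]_d) : R :=
  if `[< separation_times Omega u t r x !=set0 >]
  then ln r / `|separation_time Omega u t r x| else 0.

(* f is of class C^k on the open set U. *)
Fixpoint class_C (R : realType) (d : nat) (k : nat) (U : set 'rV[R]_d)
    (f : 'rV[R]_d -> 'rV[R]_d) : Prop :=
  match k with
  | 0%N => forall x, U x -> {for x, continuous f}
  | k'.+1 => (forall x, U x -> differentiable f x) /\
             (forall v, class_C k' U (fun x => 'D_v f x))
  end.

Definition class_Coo (R : realType) (d : nat) (U : set 'rV[R]_d)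
    (f : 'rV[R]_d -> 'rV[R]_d) : Prop :=
  forall k, class_C k U f.

(* The model of a codimension-one surface with boundary: the half-space
   y_0 >= 0 of the hyperplane where the last coordinate vanishes. In R^1 the
   two coordinates coincide and this is the point 0. *)
Definition half_hyperplane (R : realType) (d : nat) : set 'rV[R]_d.+1 :=
  [set y | y 0 ord_max = 0 /\ 0 <= y 0 ord0].

(* Embedded codimension-one surface, possibly with boundary: around each of its
   points, a diffeomorphism psi : W -> Z (with inverse phi) of the given
   regularity between open sets of the ambient space maps M to
   half_hyperplane. Points of M sent to y_0 > 0 are interior points, so the
   boundary may be empty. *)
Definition hypersurface (R : realType) (d : nat)
    (regular : set 'rV[R]_d.+1 -> ('rV[R]_d.+1 -> 'rV[R]_d.+1) -> Prop)
    (M : set 'rV[R]_d.+1) : Prop :=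
  forall p, M p ->
  exists (W Z : set 'rV[R]_d.+1) (psi phi : 'rV[R]_d.+1 -> 'rV[R]_d.+1),
    [/\ [/\ open W, W p & open Z],
        regular W psi /\ regular Z phi,
        forall x, W x -> Z (psi x) /\ phi (psi x) = x,
        forall z, Z z -> W (phi z) /\ psi (phi z) = z &
        forall x, W x -> (M x <-> half_hyperplane (psi x))].

(* One-sided velocities at p of curves in M issued from p: the tangent space of
   M at an interior point, a closed half-space spanning it at a boundary
   point. *)
Definition tangent_vector (R : realType) (d : nat) (M : set 'rV[R]_d)
    (p v : 'rV[R]_d) : Prop :=
  exists c : R -> 'rV[R]_d,
    [/\ c 0 = p, \forall h \near 0^'+, M (c h) &
        h^-1 *: (c h - c 0) @[h --> 0^'+] --> v].

Definition unit_normal (R : realType) (d : nat) (M : set 'rV[R]_d)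
    (p n : 'rV[R]_d) : Prop :=
  dotr n n = 1 /\ forall v, tangent_vector M p v -> dotr n v = 0.

Definition ridge (R : realType) (d : nat) (Omega : set 'rV[R]_d.+1)
    (f : 'rV[R]_d.+1 -> R) (M : set 'rV[R]_d.+1) : Prop :=
  [/\ M `<=` Omega, compact M, hypersurface (@class_C R d.+1 1) M &
      forall x n, M x -> unit_normal M x n ->
      exists2 delta : R, 0 < delta &
        forall s : R, `|s| < delta -> f (x + s *: n) <= f x].

Definition normal_expression (R : realType) (d : nat) (M : set 'rV[R]_d)
    (rho : R) (y x : 'rV[R]_d) (s : R) (n : 'rV[R]_d) : Prop :=
  [/\ M x, `|s| < rho, unit_normal M x n & y = x + s *: n].

(* Gamma_M(rho) *)
Definition tubular_neighbourhood (R : realType) (d : nat) (M : set 'rV[R]_d)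
    (rho : R) : set 'rV[R]_d :=
  [set y | exists x s n, normal_expression M rho y x s n /\
    forall x' s' n', normal_expression M rho y x' s' n' ->
      x' = x /\ ((s' = s /\ n' = n) \/ (s' = - s /\ n' = - n))].

(* rho is small enough for Gamma_M(rho) to be a tubular neighbourhood of M in
   Omega. *)
Definition tubular_radius (R : realType) (d : nat) (Omega M : set 'rV[R]_d)
    (rho : R) : Prop :=
  0 < rho /\
  forall y x s n, normal_expression M rho y x s n ->
    Omega y /\ tubular_neighbourhood M rho y.

(* Main.v *)
Require Import Defs.
From mathcomp Require Import all_boot all_order all_algebra.
From mathcomp Require Import all_classical all_reals all_analysis.
From mathcomp Require Import ring lra.
Set Implicit Arguments.
Unset Strict Implicit.
Unset Printing Implicit Defensive.
Import Order.TTheory GRing.Theory Num.Theory.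
Import numFieldNormedType.Exports.
Local Open Scope classical_set_scope.
Local Open Scope ring_scope.

(** The exponent is positive at [y] as soon as the separation factor [r] is
    reached during the window, at a first time that is not [0]. At time [0] the
    flow is the identity, so the square root of the largest eigenvalue is
    [1 < r]; if it exceeds [r] at time [t], it must take the value [r] in between,
    provided it varies continuously with time, and the first time at which it
    does is positive ([isle_gt0]).

    Continuity in time has to be extracted from the Lipschitz bound on [u] alone,
    since [u] need not be continuous in time. By Gronwall, two solutions stay
    within a constant times their initial distance; hence the difference of
    their displacements between times [s] and [tau] is at most
    [C * |q - p| * (tau - s)], with [p] and [q] the initial points
    ([flow_difference]). Dividing by the distance of the initial points and
    passing to the limit makes the Jacobian of the flow Lipschitz in time. The
    largest eigenvalue of a symmetric matrix is a maximum of its quadratic form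
    on the unit sphere, hence depends continuously on the entries
    ([lambda_max_cvg]). Together this is [continuous_cg_lambda_time].

    On the ridge the square root is at least [m > r] at time [t]; as it is
    continuous in space and the ridge is compact, it exceeds [r] on a whole
    thickening of the ridge ([compact_thickening]).

    What remains is that small normal segments do not meet. This rests on the
    quadratic contact of [M] with its tangent spaces:
    [|<n, x' - x>| <= K |x' - x|^2] for [x], [x'] in [M] and [n] a unit normal at
    [x] ([hypersurface_reach]). Indeed, if [x + s n = x' + s' n'] with
    [|s|, |s'| < rho], the inner product of [x' - x = s n - s' n'] with itself is
    at most [2 rho K |x' - x|^2], so that [x' = x] once [2 rho K < 1]
    ([reach_normal_expression_unique]). The quadratic contact
    holds at boundary points as well, because charts map [M] to a convex set: the
    segment joining two of its points pulls back to a curve in [M]. *)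

(** * Inner product and sup norm *)

Section Dot.
Context {R : realType} {d : nat}.
Implicit Types (v w x : 'rV[R]_d) (a : R) (A : 'M[R]_d).

Lemma dotrE v w : dotr v w = (v *m w^T) 0 0.
Proof. by rewrite mxE; apply: eq_bigr => i _; rewrite mxE. Qed.

Lemma dotrC v w : dotr v w = dotr w v.
Proof. by apply: eq_bigr => i _; rewrite mulrC. Qed.

Lemma dotrDl v w x : dotr (v + w) x = dotr v x + dotr w x.
Proof. by rewrite !dotrE mulmxDl mxE. Qed.

Lemma dotrDr v w x : dotr x (v + w) = dotr x v + dotr x w.
Proof. by rewrite dotrC dotrDl !(dotrC _ x). Qed.

Lemma dotrZl a v w : dotr (a *: v) w = a * dotr v w.
Proof. by rewrite !dotrE -scalemxAl mxE. Qed.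

Lemma dotrZr a v w : dotr v (a *: w) = a * dotr v w.
Proof. by rewrite dotrC dotrZl dotrC. Qed.

Lemma dotrBr v w x : dotr x (v - w) = dotr x v - dotr x w.
Proof. by rewrite -scaleN1r dotrDr dotrZr mulN1r. Qed.

Lemma dotr_ge0 v : 0 <= dotr v v.
Proof. by apply: sumr_ge0 => i _; rewrite -expr2 sqr_ge0. Qed.

Lemma dotr_mulmx v w A : dotr (v *m A) w = dotr v (w *m A^T).
Proof. by rewrite !dotrE trmx_mul trmxK mulmxA. Qed.

Lemma normr_coord v i : `|v 0 i| <= `|v|.
Proof.
rewrite [leRHS]/Num.Def.normr/= mx_normrE.
exact: (le_bigmax _ (fun ij : 'I_1 * 'I_d => `|v ij.1 ij.2|) (0, i)).
Qed.

Lemma rV_norm_le v a : 0 <= a -> (forall i, `|v 0 i| <= a) -> `|v| <= a.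
Proof.
move=> a0 va; rewrite /Num.Def.normr/= mx_normrE.
by apply: bigmax_le => // -[i j] _; rewrite ord1.
Qed.

Lemma dotr_coord v i : v 0 i ^+ 2 <= dotr v v.
Proof.
rewrite /dotr (bigD1 i)//= -expr2 lerDl.
by apply: sumr_ge0 => j _; rewrite -expr2 sqr_ge0.
Qed.

Lemma norm2_le_dotr v : `|v| ^+ 2 <= dotr v v.
Proof.
rewrite -ler_sqrt ?dotr_ge0// sqrtr_sqr normr_id.
apply: rV_norm_le; first exact: sqrtr_ge0.
by move=> i; rewrite -sqrtr_sqr ler_sqrt ?dotr_ge0 ?dotr_coord.
Qed.

Lemma normr_dotr v w : `|dotr v w| <= d%:R * (`|v| * `|w|).
Proof.
rewrite /dotr; apply: le_trans (ler_norm_sum _ _ _) _.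
have -> : d%:R * (`|v| * `|w|) = \sum_(i < d) `|v| * `|w|.
  by rewrite sumr_const card_ord mulr_natl.
by apply: ler_sum => i _; rewrite normrM ler_pM ?normr_coord.
Qed.

Lemma dotr_le_norm2 v : dotr v v <= d%:R * `|v| ^+ 2.
Proof. by apply: le_trans (normr_dotr v v); rewrite ler_norm. Qed.

Lemma dotr_eq0 v : dotr v v = 0 -> v = 0.
Proof.
move=> v0; apply/eqP; rewrite -normr_eq0 -sqrf_eq0 eq_le sqr_ge0 andbT.
by rewrite -v0 norm2_le_dotr.
Qed.

Lemma dotr_unit_norm v : dotr v v = 1 -> `|v| <= 1.
Proof.
by move=> v1; have := norm2_le_dotr v; rewrite v1 expr_le1 ?normr_ge0.
Qed.

Lemma cvg_coord (T : Type) (F : set_system T) {FF : Filter F}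
    (f : T -> 'rV[R]_d) v i :
  f x @[x --> F] --> v -> f x 0 i @[x --> F] --> v 0 i.
Proof.
move=> fv; apply: (@continuous_cvg _ _ _ F FF f (fun w : 'rV[R]_d => w 0 i)) fv.
exact: coord_continuous.
Qed.

Lemma cvg_dotr (T : Type) (F : set_system T) {FF : Filter F}
    (f g : T -> 'rV[R]_d) v w :
  f x @[x --> F] --> v -> g x @[x --> F] --> w ->
  dotr (f x) (g x) @[x --> F] --> dotr v w.
Proof.
move=> fv gw; apply: cvg_big => [|i _]; first exact: add_continuous.
by apply: cvgM; exact: cvg_coord.
Qed.

End Dot.

(** * Largest eigenvalue of a symmetric matrix *)

Section Rayleigh.
Context {R : realType} {d : nat}.
Implicit Types (v w : 'rV[R]_d.+1) (A B : 'M[R]_d.+1).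

Lemma compact_unit_sphere : compact [set v : 'rV[R]_d.+1 | dotr v v = 1].
Proof.
apply: bounded_closed_compact.
  exists 1; split; first exact: num_real.
  by move=> M M1 v /= /dotr_unit_norm/le_trans; apply; exact: ltW.
rewrite (_ : mkset _ = (fun v => dotr v v) @^-1` [set 1])//.
apply: preimage_closed; last exact: closed_eq.
by move=> v _; exact: (@cvg_dotr _ _ _ (nbhs v) _ id id v v cvg_id cvg_id).
Qed.

Lemma continuous_quadratic A : continuous (fun v => dotr (v *m A) v).
Proof.
move=> v; apply: (@cvg_big _ _ +%R 0 _ add_continuous _ (nbhs v)) => i _.
apply: cvgM; last exact: coord_continuous.
under eq_fun do rewrite mxE; rewrite mxE.
apply: (@cvg_big _ _ +%R 0 _ add_continuous _ (nbhs v)) => k _.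
by apply: (@cvgMr_tmp _ _ (nbhs v)); exact: coord_continuous.
Qed.

Lemma rayleigh_max A : exists2 v, dotr v v = 1 &
  forall w, dotr (w *m A) w <= dotr (v *m A) v * dotr w w.
Proof.
have sph0 : [set v : 'rV[R]_d.+1 | dotr v v = 1] !=set0.
  exists (delta_mx 0 0); rewrite /= /dotr (bigD1 0)//= big1 ?addr0.
    by rewrite !mxE eqxx mulr1.
  by move=> i /negbTE i0; rewrite !mxE i0 mul0r.
have [v /[!inE] v1 vmax] := EVT_max_rV sph0 compact_unit_sphere
  (continuous_subspaceT (@continuous_quadratic A)).
exists v => // w; have [w0|w0] := eqVneq (dotr w w) 0.
  by rewrite w0 mulr0 (dotr_eq0 w0) mul0mx -(scale0r 0) dotrZl mul0r.
have ww : 0 < dotr w w by rewrite lt_neqAle eq_sym w0 dotr_ge0.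
set s := (Num.sqrt (dotr w w))^-1.
have s2 : s * s = (dotr w w)^-1 by rewrite -invfM -expr2 sqr_sqrtr ?dotr_ge0.
have := vmax (s *: w); rewrite inE /= -scalemxAl !(dotrZl, dotrZr) !mulrA s2.
by rewrite mulVf// => /(_ erefl); rewrite mulrC ler_pdivrMr.
Qed.

(** First-order condition at a maximum of the Rayleigh quotient: the residual
    [w = v A - a v] must vanish, because moving from [v] in the direction [w]
    would raise the quotient at the rate [2 <w, w>]. *)
Lemma rayleigh_eigen A v : A^T = A -> dotr v v = 1 ->
  (forall w, dotr (w *m A) w <= dotr (v *m A) v * dotr w w) ->
  v *m A = dotr (v *m A) v *: v.
Proof.
move=> symA v1; set a := dotr _ v => ray.
apply/eqP; rewrite -subr_eq0; apply/eqP.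
set w := _ - _; apply: dotr_eq0.
have wE : dotr w w = dotr (v *m A) w - a * dotr v w.
  have wdef : w = v *m A + - a *: v by rewrite scaleNr.
  by rewrite {1}wdef dotrDl dotrZl mulNr.
have vwA : dotr (w *m A) v = dotr (v *m A) w.
  by rewrite dotr_mulmx symA dotrC.
clearbody w.
(* maximality of [v] tested at [v + e *: w] *)
have Q e : 0 <= - (2 * e * dotr w w) + e ^+ 2 * (a * dotr w w - dotr (w *m A) w).
  have := ray (v + e *: w).
  rewrite mulmxDl !(dotrDl, dotrDr) -scalemxAl !(dotrZl, dotrZr) vwA v1 -/a.
  rewrite (dotrC w v) (_ : dotr (v *m A) w = dotr w w + a * dotr v w); last first.
    by rewrite wE subrK.
  move: (dotr w w) (dotr v w) (dotr (w *m A) w) => x y z.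
  lra.
apply/eqP; rewrite eq_le dotr_ge0 andbT leNgt; apply/negP => w0.
set b := (a * dotr w w - dotr (w *m A) w) in Q.
have [b0|b0] := leP b 0.
  have := Q 1; nra.
(* the step at which the quadratic polynomial in [e] is smallest *)
have := Q (dotr w w / b).
rewrite expr_div_n.
have -> : dotr w w ^+ 2 / b ^+ 2 * b = dotr w w ^+2 / b by field; rewrite gt_eqF.
have : 0 < dotr w w ^+ 2 / b by rewrite divr_gt0 ?exprn_gt0.
nra.
Qed.

Lemma lambda_maxP A : A^T = A ->
  exists2 v, dotr v v = 1 & lambda_max A = dotr (v *m A) v /\
    forall w, dotr (w *m A) w <= lambda_max A * dotr w w.
Proof.
move=> symA; have [v v1 ray] := rayleigh_max A; exists v => //.
suff -> : lambda_max A = dotr (v *m A) v by [].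
rewrite /lambda_max; set a := dotr _ _; set S := [set _ | _].
have ubS : ubound S a.
  move=> b /= /eigenvalueP[w wb w0].
  have w2 : 0 < dotr w w.
    by rewrite lt_neqAle dotr_ge0 andbT eq_sym; apply: contra w0 => /eqP/dotr_eq0->.
  by have := ray w; rewrite wb dotrZl ler_pM2r.
have Sa : S a.
  apply/eigenvalueP; exists v; first exact: rayleigh_eigen.
  apply/eqP => v0; move: v1; rewrite v0 -(scale0r 0) dotrZl mul0r => /eqP.
  by rewrite eq_sym oner_eq0.
apply/eqP; rewrite eq_le; apply/andP; split; first by apply: ge_sup => //; exists a.
by apply: ub_le_sup => //; exists a.
Qed.

(** Compares the two quadratic forms at a maximizer of the first one; entries of
    a unit vector have absolute value at most [1]. *)
Lemma lambda_max_le A B : A^T = A -> B^T = B ->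
  lambda_max A <= lambda_max B + \sum_i \sum_j `|A i j - B i j|.
Proof.
move=> symA symB; have [v v1 [-> _]] := lambda_maxP symA.
have [_ _ [_ /(_ v)]] := lambda_maxP symB; rewrite v1 mulr1 => vB.
rewrite -lerBlDl; apply: le_trans (_ : dotr (v *m A) v - dotr (v *m B) v <= _).
  by rewrite lerD2l lerN2.
have -> : dotr (v *m A) v - dotr (v *m B) v = dotr v (v *m (A - B)).
  by rewrite mulmxBr dotrBr !(dotrC v).
rewrite exchange_big/=; apply: ler_sum => j _.
rewrite mxE mulr_sumr; apply: ler_sum => i _; rewrite !mxE.
apply: le_trans (ler_norm _) _; rewrite !normrM mulrA ler_piMl//.
by rewrite mulr_ile1// (le_trans (normr_coord _ _))// dotr_unit_norm.
Qed.

Lemma lambda_max_cvg (T : Type) (F : set_system T) {FF : Filter F}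
    (A : T -> 'M[R]_d.+1) B : (forall x, (A x)^T = A x) -> B^T = B ->
  (forall i j, A x i j @[x --> F] --> B i j) ->
  lambda_max (A x) @[x --> F] --> lambda_max B.
Proof.
move=> symA symB AB; apply/cvgrPdist_le => e e0.
have AB0 : (\sum_i \sum_j `|A x i j - B i j|) @[x --> F] --> (0 : R).
  rewrite -[X in _ --> X](_ : \sum_(i < d.+1) \sum_(j < d.+1) 0 = _); last first.
    by rewrite big1// => i _; rewrite big1.
  apply: (@cvg_big _ _ +%R 0 _ add_continuous _ F) => i _.
  apply: (@cvg_big _ _ +%R 0 _ add_continuous _ F) => j _.
  apply/norm_cvg0P; rewrite -[X in _ --> X](subrr (B i j)).
  by apply: cvgB => //; exact: cvg_cst.
near=> x.
have : `|\sum_i \sum_j `|A x i j - B i j| | <= e.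
  by near: x; apply: (proj1 (cvgr0Pnorm_le _) AB0).
rewrite ger0_norm; last by rewrite sumr_ge0// => i _; rewrite sumr_ge0.
apply: le_trans; rewrite ler_norml; apply/andP; split.
  by rewrite lerNl opprB lerBlDl; exact: lambda_max_le.
rewrite lerBlDl; apply: le_trans (lambda_max_le symB (symA x)) _.
by rewrite lerD2l; apply: ler_sum => i _; apply: ler_sum => j _; rewrite distrC.
Unshelve. all: by end_near. Qed.

End Rayleigh.

(** * Mean value inequality and Gronwall lemma *)

Section Calculus.
Context {R : realType} {d : nat}.
Implicit Types (a b c s : R) (x : R -> 'rV[R]_d).

Lemma within_continuous_coord (A : set R) x i :
  {within A, continuous x} -> {within A, continuous (fun s => x s 0 i)}.
Proof.
move=> /subspace_continuousP cx; apply/subspace_continuousP => s As.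
exact: cvg_coord (cx s As).
Qed.

Lemma is_derive_coord x s v i :
  is_derive s 1 x v -> is_derive s 1 (fun s => x s 0 i) (v 0 i).
Proof.
move=> [dx <-]; have dxi := (derivable_mxP x s 1).1 dx 0 i.
by apply: DeriveDef => //; rewrite derive_mx// mxE.
Qed.

Lemma is_derive_dotr x s v :
  is_derive s 1 x v -> is_derive s 1 (fun s => dotr (x s) (x s)) (2 * dotr (x s) v).
Proof.
move=> dx.
rewrite (_ : (fun _ => _) = \sum_(i < d) (fun s => x s 0 i * x s 0 i)); last first.
  by rewrite fct_sumE.
rewrite (_ : 2 * _ = \sum_(i < d) (x s 0 i * v 0 i + x s 0 i * v 0 i)).
  apply: is_derive_sum => i; have dxi := is_derive_coord i dx.
  exact: is_deriveM.
by rewrite mulr_sumr; apply: eq_bigr => i _; ring.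
Qed.

(** The mean value theorem applies to each coordinate separately, which is
    exactly what the sup norm sees. *)
Lemma mean_value_rV x (dx : R -> 'rV[R]_d) a b c : a <= b -> 0 <= c ->
  {within `[a, b], continuous x} ->
  (forall s, s \in `]a, b[ -> is_derive s 1 x (dx s) /\ `|dx s| <= c) ->
  `|x b - x a| <= c * (b - a).
Proof.
move=> ab c0 cx dxP; apply: rV_norm_le => [|i]; first by rewrite mulr_ge0 ?subr_ge0.
move: ab; rewrite le_eqVlt => /predU1P[->|ab]; first by rewrite !subrr mulr0 mxE normr0.
have [||s sab] := @MVT R (fun s => x s 0 i) (fun s => dx s 0 i) a b ab.
- by move=> s /dxP[dxs _]; exact: is_derive_coord.
- exact: within_continuous_coord.
rewrite !mxE => ->; rewrite normrM (gtr0_norm (x := b - a)) ?subr_gt0//.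
rewrite ler_wpM2r ?subr_ge0 ?(ltW ab)//; apply: le_trans (normr_coord _ _) _.
by have [] := dxP s sab.
Qed.

(** [expR (- c * s) * g s] is nonincreasing. *)
Lemma gronwall (g dg : R -> R) c a b : a <= b ->
  {within `[a, b], continuous g} ->
  (forall s, s \in `]a, b[ -> is_derive s 1 g (dg s) /\ dg s <= c * g s) ->
  g b <= expR (c * (b - a)) * g a.
Proof.
rewrite le_eqVlt => /predU1P[->|ab] cg dgP; first by rewrite subrr mulr0 expR0 mul1r.
pose h s := expR (- c * s) * g s.
have [||s sab hba] := @MVT R h (fun s => expR (- c * s) * (dg s - c * g s)) a b ab.
- move=> s /dgP[dgs _].
  have de : is_derive s 1 (fun s => expR (- c * s)) (expR (- c * s) * - c).
    rewrite (_ : (fun _ => _) = expR \o (fun s => - c * s))//.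
    apply: is_derive1_comp.
    have := is_deriveM (is_derive_cst (- c : R) s 1) (is_derive_id s 1).
    by rewrite scaler0 addr0 [_%:A]mulr1.
  have deg := is_deriveM de dgs; apply: is_derive_eq.
  rewrite /GRing.scale /=; ring.
- apply/subspace_continuousP => s sab; apply: cvgM.
    apply: cvg_trans (cvg_app _ (cvg_within _)) _.
    apply: (@continuous_comp _ _ _ (fun s => - c * s) expR).
      exact: mulrl_continuous.
    exact: continuous_expR.
  exact: ((subspace_continuousP _ _).1 cg s sab).
have : h b <= h a.
  rewrite -subr_le0 hba mulr_le0_ge0 ?subr_ge0 ?(ltW ab)//.
  have [_ dgs] := dgP s sab.
  by rewrite mulr_ge0_le0 ?expR_ge0// subr_le0.
rewrite /h.
rewrite -(ler_pM2l (expR_gt0 (c * b))) !mulrA -!expRD.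
by rewrite mulNr subrr expR0 mul1r mulNr -mulrBr.
Qed.

End Calculus.

(** * Dependence of the flow on time *)

Section Flow.
Context {R : realType} {d : nat}.
Context (Omega : set 'rV[R]_d.+1) (u : 'rV[R]_d.+1 -> R -> 'rV[R]_d.+1).
Implicit Types (t s tau : R) (x y : R -> 'rV[R]_d.+1) (p : 'rV[R]_d.+1).

Lemma solution_ge0 t x : 0 <= t -> solution Omega u 0 t x <->
  [/\ forall s, s \in `[0, t] -> Omega (x s), {within `[0, t], continuous x} &
      forall s, s \in `]0, t[ -> is_derive s 1 x (u (x s) s)].
Proof. by move=> t0; rewrite /solution min_l// max_r. Qed.

Lemma solution_restrict t tau x : 0 <= tau <= t ->
  solution Omega u 0 t x -> solution Omega u 0 tau x.
Proof.
move=> /andP[tau0 taut]; rewrite !solution_ge0 ?(le_trans tau0)// => -[xO cx dx].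
split => [s|| s].
- by rewrite in_itv/= => /andP[s0 st]; apply: xO; rewrite in_itv/= s0 (le_trans st).
- by apply: continuous_subspaceW cx; apply: subset_itvl; rewrite bnd_simp.
- by rewrite in_itv/= => /andP[s0 st]; apply: dx; rewrite in_itv/= s0 (lt_le_trans st).
Qed.

(** Gronwall is applied to the square of the Euclidean norm of the difference
    [w], which is differentiable, and the result is read in the sup norm. It
    bounds [w], hence its derivative by the Lipschitz condition, and the mean
    value inequality then controls the increments of [w] in time. *)
Lemma solution_difference t : lipschitz_velocity Omega u -> 0 <= t ->
  exists2 C, 0 <= C & forall x y, solution Omega u 0 t x -> solution Omega u 0 t y ->
    (forall s, s \in `[0, t] -> `|y s - x s| <= C * `|y 0 - x 0|) /\
    (forall s tau, 0 <= s -> s <= tau -> tau <= t ->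
      `|(y tau - x tau) - (y s - x s)| <= C * `|y 0 - x 0| * (tau - s)).
Proof.
move=> lipu t0; have [L0 lipL0] := lipu t; pose L := `|L0|.
have lipL s p q : 0 <= s <= t -> Omega p -> Omega q ->
    `|u p s - u q s| <= L * `|p - q|.
  move=> /andP[s0 st] Op Oq; apply: le_trans (_ : L0 * `|p - q| <= _).
    by apply: (lipL0 s _ (p, q)) => //=; rewrite ger0_norm.
  by rewrite ler_wpM2r// ler_norm.
pose K := d.+1%:R * L; pose B := expR (2 * K * t) * d.+1%:R.
have L0' : 0 <= L by exact: normr_ge0.
have K0 : 0 <= K by rewrite mulr_ge0.
have B0 : 0 <= B by rewrite mulr_ge0 ?expR_ge0.
(* [Num.sqrt B] serves for the distance and [L * Num.sqrt B] for its increments *)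
exists ((1 + L) * Num.sqrt B); first by rewrite mulr_ge0 ?sqrtr_ge0 ?addr_ge0.
move=> x y; rewrite !solution_ge0// => -[xO cx dx] [yO cy dy].
pose w := y - x.
have cw : {within `[0, t], continuous w}.
  apply/subspace_continuousP => s st; apply: cvgB.
    exact: ((subspace_continuousP _ _).1 cy s st).
  exact: ((subspace_continuousP _ _).1 cx s st).
have dw s : s \in `]0, t[ -> is_derive s 1 w (u (y s) s - u (x s) s).
  by move=> st; apply: is_deriveB; [exact: dy|exact: dx].
have dwL s : s \in `]0, t[ -> `|u (y s) s - u (x s) s| <= L * `|w s|.
  move=> st; have st' : s \in `[0, t] by exact: subset_itv_oo_cc st.
  by apply: lipL; [move: st'; rewrite in_itv|exact: yO|exact: xO].
have wB s : s \in `[0, t] -> `|w s| <= Num.sqrt B * `|w 0|.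
  rewrite in_itv/= => /andP[s0 st].
  rewrite -(ler_pXn2r (n := 2)) ?nnegrE ?mulr_ge0 ?sqrtr_ge0// exprMn sqr_sqrtr//.
  apply: le_trans (norm2_le_dotr _) _.
  have sub0 z : z \in `]0, s[ -> z \in `]0, t[.
    by rewrite !in_itv/= => /andP[-> /lt_le_trans]; apply.
  have : dotr (w s) (w s) <= expR (2 * K * (s - 0)) * dotr (w 0) (w 0).
    apply: (@gronwall R (fun s => dotr (w s) (w s))
      (fun s => 2 * dotr (w s) (u (y s) s - u (x s) s))) => // [|z /sub0 zt].
      apply/subspace_continuousP => z /=; rewrite in_itv/= => /andP[z0 zs].
      have cwz : w x0 @[x0 --> within `[0, s] (nbhs z)] --> w z.
        apply: ((subspace_continuousP _ _).1 _ z); last by rewrite /= in_itv/= z0.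
        by apply: continuous_subspaceW cw; apply: subset_itvl; rewrite bnd_simp.
      exact: cvg_dotr.
    split; first exact: is_derive_dotr (dw z zt).
    rewrite -mulrA ler_wpM2l//; apply: le_trans (ler_norm _) _.
    apply: le_trans (normr_dotr _ _) _; rewrite -mulrA ler_wpM2l//.
    apply: le_trans (_ : `|w z| * (L * `|w z|) <= _); first by rewrite ler_wpM2l ?dwL.
    by rewrite mulrCA -expr2 ler_wpM2l// norm2_le_dotr.
  move=> /le_trans; apply; rewrite /B -[leRHS]mulrA.
  apply: ler_pM; rewrite ?expR_ge0 ?dotr_ge0 ?dotr_le_norm2//.
  by rewrite ler_expR subr0 ler_wpM2l// mulr_ge0.
split => [s st|s tau s0 stau taut].
  apply: le_trans (wB s st) _.
  by rewrite -mulrA ler_peMl ?mulr_ge0 ?sqrtr_ge0// lerDl.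
apply: (@mean_value_rV _ _ w (fun s => u (y s) s - u (x s) s)) => //.
- by rewrite !mulr_ge0 ?sqrtr_ge0 ?addr_ge0.
- apply: continuous_subspaceW cw => z /=; rewrite !in_itv/= => /andP[sz zt].
  by rewrite (le_trans s0)// (le_trans zt).
- move=> z; rewrite in_itv/= => /andP[sz zt].
  have zt0 : z \in `]0, t[ by rewrite in_itv/= (le_lt_trans s0)//= (lt_le_trans zt).
  split; first exact: dw.
  apply: le_trans (dwL z zt0) _; rewrite mulrDl mul1r mulrDl.
  apply: le_trans (_ : L * (Num.sqrt B * `|w 0|) <= _).
    by rewrite ler_wpM2l// wB//; exact: subset_itv_oo_cc zt0.
  by rewrite mulrA lerDr mulr_ge0 ?sqrtr_ge0.
Qed.

(** Solutions are unique, being at distance [0] initially. *)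
Lemma flow_solution t tau x : lipschitz_velocity Omega u -> 0 <= tau <= t ->
  solution Omega u 0 t x -> flow Omega u 0 tau (x 0) = x tau.
Proof.
move=> lipu taut solx; have /andP[tau0 _] := taut; rewrite /flow.
set S := [set y | _].
have [y [soly y0 ->]] : S (xget (x 0) S).
  by apply: xgetPex; exists (x tau), x; split => //; exact: solution_restrict solx.
have [C _ /(_ y x soly (solution_restrict taut solx))[+ _]] := solution_difference lipu tau0.
move=> /(_ tau); rewrite in_itv/= lexx tau0 => /(_ erefl).
by rewrite y0 subrr normr0 mulr0 normr_le0 subr_eq0 => /eqP.
Qed.

(** Constant curves solve the equation on [`[0, 0]], whose interior is empty. *)
Lemma flow0 p : Omega p -> flow Omega u 0 0 p = p.
Proof.
move=> Op; rewrite /flow; set S := [set y | _].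
have [y [_ y0 ->]] : S (xget p S); last by [].
apply: xgetPex; exists p, (cst p); split => //.
rewrite solution_ge0//; split => // [|s].
  by apply: continuous_subspaceT => ?; exact: cvg_cst.
by rewrite in_itv/= => /andP[s0 /(lt_trans s0)]; rewrite ltxx.
Qed.

Lemma flow_difference t : lipschitz_velocity Omega u -> 0 <= t ->
  flow_exists Omega u 0 t ->
  exists2 C, 0 <= C & forall p q s tau, Omega p -> Omega q ->
    0 <= s -> s <= tau -> tau <= t ->
    `|(flow Omega u 0 tau q - flow Omega u 0 tau p) -
      (flow Omega u 0 s q - flow Omega u 0 s p)| <= C * `|q - p| * (tau - s).
Proof.
move=> lipu t0 ex; have [C C0 HC] := solution_difference lipu t0.
exists C => // p q s tau /ex[x solx x0] /ex[y soly y0] s0 stau taut.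
have st : 0 <= s <= t by rewrite s0 (le_trans stau).
have taut' : 0 <= tau <= t by rewrite taut (le_trans s0).
rewrite -x0 -y0 !(flow_solution lipu _ solx)// !(flow_solution lipu _ soly)//.
by have [_ ->] := HC x y solx soly.
Qed.

Lemma near_line (U : set 'rV[R]_d.+1) p v : open U -> U p ->
  \forall h \near (0 : R), U (h *: v + p).
Proof.
move=> openU Up.
have : (h *: v + p) @[h --> (0 : R)] --> p.
  rewrite -[X in _ --> X]add0r -(scale0r v); apply: cvgD; last exact: cvg_cst.
  by apply: cvgZr_tmp; exact: cvg_id.
by apply; exact: open_nbhs_nbhs.
Qed.

Lemma jacobian_entry (f : 'rV[R]_d.+1 -> 'rV[R]_d.+1) p i j :
  differentiable f p -> 'J f p i j = ('D_(delta_mx 0 i) f p) 0 j.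
Proof. by move=> df; rewrite deriveEjacobian// -rowE [RHS]mxE. Qed.

(** The left-hand side is a coordinate of the difference of two rows. *)
Lemma jacobian_difference (f g : 'rV[R]_d.+1 -> 'rV[R]_d.+1) p i j :
  differentiable f p -> differentiable g p ->
  `|'J f p i j - 'J g p i j| <= `|'D_(delta_mx 0 i) f p - 'D_(delta_mx 0 i) g p|.
Proof.
move=> /(jacobian_entry i j) Jf /(jacobian_entry i j) Jg.
set v : 'rV[R]_d.+1 := delta_mx 0 i.
suff H (a b : R) (x y : 'rV[R]_d.+1) : a = x 0 j -> b = y 0 j -> `|a - b| <= `|x - y|.
  exact: H Jf Jg.
move=> -> ->.
by apply: le_trans (normr_coord _ j); rewrite !mxE.
Qed.

(** Difference quotients of the flow at two times differ by at most
    [C * (tau - s)], and this passes to the limit. *)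
Lemma jacobian_flow_difference t : open Omega -> lipschitz_velocity Omega u -> 0 <= t ->
  flow_exists Omega u 0 t ->
  (forall tau p, 0 <= tau <= t -> Omega p -> differentiable (flow Omega u 0 tau) p) ->
  exists2 C, 0 <= C & forall p i j s tau, Omega p -> 0 <= s -> s <= tau -> tau <= t ->
    `|'J (flow Omega u 0 tau) p i j - 'J (flow Omega u 0 s) p i j| <= C * (tau - s).
Proof.
move=> openO lipu t0 ex df; have [C C0 HC] := flow_difference lipu t0 ex.
exists C => // p i j s tau Op s0 stau taut.
have dfs : differentiable (flow Omega u 0 s) p.
  by apply: df => //; rewrite s0 (le_trans stau).
have dft : differentiable (flow Omega u 0 tau) p.
  by apply: df => //; rewrite taut (le_trans s0).
apply: le_trans (jacobian_difference i j dft dfs) _.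
set v : 'rV[R]_d.+1 := delta_mx 0 i.
have cvs := diff_derivable (v := v) dfs; have cvt := diff_derivable (v := v) dft.
apply: (cvgr_to_le (cvg_norm (cvgB cvt cvs))).
have v1 : `|v| <= 1.
  apply: rV_norm_le => // k; rewrite mxE eqxx/=.
  by case: (_ == _); rewrite ?normr1 ?normr0.
have near_Omega : \forall h \near 0^', Omega (h *: v + p).
  exact/nbhs_dnbhs/near_line.
near=> h.
have Oh : Omega (h *: v + p) by near: h.
have h0 : h != 0 by near: h; exact: nbhs_dnbhs_neq.
rewrite !fctE /= -scalerBr normrZ normfV ler_pdivrMl ?normr_gt0//.
apply: le_trans (HC p (h *: v + p) s tau Op Oh s0 stau taut) _.
rewrite addrK normrZ [leRHS]mulrA ler_wpM2r ?subr_ge0// [leRHS]mulrC.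
by rewrite ler_wpM2l// ler_piMr.
Unshelve. all: by end_near. Qed.

(** Convergence of the Cauchy-Green tensor, in terms of the transpose [A] of
    the gradient. *)
Lemma cvg_gram (T : Type) (F : set_system T) {FF : Filter F}
    (A : T -> 'M[R]_d.+1) (B : 'M[R]_d.+1) :
  (forall i j, A x i j @[x --> F] --> B i j) ->
  forall i j, (((A x)^T)^T *m (A x)^T) i j @[x --> F] --> ((B^T)^T *m B^T) i j.
Proof.
move=> AB i j; under eq_fun do rewrite trmxK mxE; rewrite trmxK mxE.
apply: (@cvg_big _ _ +%R 0 _ add_continuous _ F) => k _.
by under eq_fun do rewrite mxE; rewrite mxE; apply: cvgM; exact: AB.
Qed.

Lemma cauchy_green_sym tau p :
  (cauchy_green Omega u 0 tau p)^T = cauchy_green Omega u 0 tau p.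
Proof. by rewrite /cauchy_green trmx_mul trmxK. Qed.

Lemma continuous_cg_lambda_time t p : open Omega ->
  lipschitz_velocity Omega u -> 0 <= t -> flow_exists Omega u 0 t ->
  (forall tau q, 0 <= tau <= t -> Omega q -> differentiable (flow Omega u 0 tau) q) ->
  Omega p -> {within `[0, t], continuous (fun tau => cg_lambda Omega u 0 tau p)}.
Proof.
move=> openO lipu t0 ex df Op.
have [C C0 HC] := jacobian_flow_difference openO lipu t0 ex df.
apply/subspace_continuousP => s st.
apply: lambda_max_cvg => [tau||]; [exact: cauchy_green_sym..|].
have cJ l j : 'J (flow Omega u 0 tau) p l j @[tau --> within `[0, t] (nbhs s)]
    --> 'J (flow Omega u 0 s) p l j.
  apply/cvgrPdist_le => e e0; rewrite near_withinE.
  have C1 : 0 < C + 1 by rewrite ltr_wpDl.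
  near=> tau => taut.
  have JC : `|'J (flow Omega u 0 s) p l j - 'J (flow Omega u 0 tau) p l j|
      <= C * `|s - tau|.
    move: st taut; rewrite /= !in_itv/= => /andP[s0 st] /andP[tau0 taut].
    have [taus|/ltW stau] := leP tau s.
      by rewrite (ger0_norm (x := s - tau)) ?subr_ge0// HC.
    by rewrite distrC (distrC s) (ger0_norm (x := tau - s)) ?subr_ge0// HC.
  apply: le_trans JC _; apply: le_trans (_ : (C + 1) * `|s - tau| <= _).
    by rewrite ler_wpM2r// lerDl.
  rewrite -ler_pdivlMl//; near: tau.
  by apply: cvgr_dist_le; [exact: cvg_id|rewrite mulr_gt0 ?invr_gt0].
exact: cvg_gram cJ.
Unshelve. all: by end_near. Qed.

Lemma cg_lambda_time0 p : open Omega -> Omega p ->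
  differentiable (flow Omega u 0 0) p -> cg_lambda Omega u 0 0 p = 1.
Proof.
move=> openO Op dflow; rewrite /cg_lambda.
have near_id : \forall q \near p, flow Omega u 0 0 q = q.
  by near=> q; apply: flow0; near: q; exact: open_nbhs_nbhs.
have J1 : 'J (flow Omega u 0 0) p = 1%:M.
  apply/matrixP => a b; apply: etrans (jacobian_entry a b dflow) _.
  by rewrite (near_eq_derive _ near_id) derive_id !mxE eqxx/= eq_sym.
have -> : cauchy_green Omega u 0 0 p = 1%:M.
  by rewrite /cauchy_green /gradient_mx J1 trmxK mul1mx trmx1.
have [v v1 [-> _]] := @lambda_maxP R d 1%:M (trmx1 _ _).
by rewrite mulmx1.
Unshelve. all: by end_near. Qed.

End Flow.

(** * Positivity of the exponent *)

Section Isle.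
Context {R : realType} {d : nat}.
Context (Omega : set 'rV[R]_d.+1) (u : 'rV[R]_d.+1 -> R -> 'rV[R]_d.+1).

(** The level set is nonempty by the intermediate value theorem and compact, as
    a closed subset of the segment. *)
Lemma within_level_set_minimum (g : R -> R) (t c : R) : 0 <= t ->
  {within `[0, t], continuous g} -> g 0 <= c <= g t ->
  exists tau, minimum_of [set tau | 0 <= tau <= t /\ g tau = c] tau.
Proof.
move=> t0 cg /andP[g0c cgt]; set S := [set _ | _].
have S0 : S !=set0.
  have [|s] := IVT t0 cg (v := c); last by rewrite in_itv; exists s.
  by rewrite ge_min g0c le_max cgt orbT.
have cptS : compact S.
  have /closed_subspaceP[V clV VS] : closed (g @^-1` [set c] : set (subspace `[0, t])).
    by apply: preimage_closed; [move=> x _; exact: cg|exact: closed_eq].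
  rewrite (_ : S = V `&` `[0, t]); last first.
    rewrite VS; apply/seteqP; split => s /=; first by rewrite in_itv/= => -[].
    by rewrite in_itv/= => -[].
  apply: subclosed_compact (@segment_compact _ 0 t) _; last exact: subIsetr.
  by apply: closedI => //; exact: itv_closed.
have [s /[!inE] Ss smin] := compact_EVT_min S0 cptS (continuous_subspaceT (fun x => cvg_id)).
by exists s; split => // s' Ss'; apply: smin; rewrite inE.
Qed.

Lemma isle_gt0 (t r : R) p : open Omega -> lipschitz_velocity Omega u -> 0 <= t ->
  flow_exists Omega u 0 t ->
  (forall tau q, 0 <= tau <= t -> Omega q -> differentiable (flow Omega u 0 tau) q) ->
  Omega p -> 1 < r -> r < Num.sqrt (cg_lambda Omega u 0 t p) ->
  0 < isle Omega u t r p.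
Proof.
move=> openO lipu t0 ex df Op r1 rt.
pose g tau := Num.sqrt (cg_lambda Omega u 0 tau p).
have cg : {within `[0, t], continuous g}.
  apply/subspace_continuousP => s st.
  have := (subspace_continuousP _ _).1 (continuous_cg_lambda_time openO lipu t0 ex df Op) s st.
  apply: (@continuous_cvg _ _ _ _ _ _ (@Num.sqrt R)); exact: sqrt_continuous.
have g0 : g 0 = 1 by rewrite /g cg_lambda_time0 ?sqrtr1//; apply: df; rewrite ?lexx.
have exmin : exists tau, minimum_of (separation_times Omega u t r p) tau.
  by apply: (within_level_set_minimum t0 cg); rewrite g0 !ltW.
have [[]] : minimum_of (separation_times Omega u t r p) (separation_time Omega u t r p).
  exact: xgetPex exmin.
set tau := separation_time _ _ _ _ _ => /andP[tau0 taut] gtau _.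
rewrite /isle; case: asboolP => [_|]; last first.
  by case: exmin => s [Ss _] []; exists s.
rewrite divr_gt0 ?ln_gt0// normr_gt0; apply/negP => /eqP tau_eq0.
by move: gtau r1; rewrite (_ : tau = 0)// -/(g 0) g0 => ->; rewrite ltxx.
Qed.

End Isle.

(** * Functions of class C^1 on segments *)

Section Differential.
Context {R : realType} {d : nat}.
Notation V := 'rV[R]_d.+1.
Notation basis i := (delta_mx 0 i : V).
Implicit Types (f : V -> V) (x y z w p v : V) (U : set V).

Lemma line_derivative_quotient f z w s :
  (fun h => h^-1 *: (((fun r : R => f (z + r *: w)) \o shift s) (h *: 1) - f (z + s *: w))) =
  (fun h => h^-1 *: ((f \o shift (z + s *: w)) (h *: w) - f (z + s *: w))).
Proof.
apply/funext => h /=; congr (_ *: (f _ - _)).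
by rewrite [h *: 1]mulr1 scalerDl addrCA.
Qed.

Lemma is_derive_line f z w s : differentiable f (z + s *: w) ->
  is_derive s 1 (fun r => f (z + r *: w)) ('D_w f (z + s *: w)).
Proof.
move=> df; have dw := diff_derivable (v := w) df; apply: DeriveDef.
  by rewrite /derivable line_derivative_quotient.
by rewrite {1}/derive line_derivative_quotient.
Qed.

Lemma derive_decomp f z w : differentiable f z ->
  'D_w f z = \sum_i w 0 i *: 'D_(basis i) f z.
Proof.
move=> df; rewrite deriveE// {1}(row_sum_delta w) linear_sum.
by apply: eq_bigr => i _; rewrite linearZ deriveE.
Qed.

Lemma sum_scale_norm_le w (v : 'I_d.+1 -> V) c : (forall i, `|v i| <= c) ->
  `|\sum_i w 0 i *: v i| <= d.+1%:R * c * `|w|.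
Proof.
move=> vc; apply: le_trans (ler_norm_sum _ _ _) _.
have -> : d.+1%:R * c * `|w| = \sum_(i < d.+1) `|w| * c.
  by rewrite sumr_const card_ord -mulr_natl; ring.
by apply: ler_sum => i _; rewrite normrZ ler_pM// normr_coord.
Qed.

Lemma segment_ball p x y e s : `|p - x| < e -> `|p - y| < e -> 0 <= s <= 1 ->
  `|p - (x + s *: (y - x))| < e.
Proof.
move=> px py /andP[s0 s1].
have -> : p - (x + s *: (y - x)) = (1 - s) *: (p - x) + s *: (p - y).
  by apply/rowP => i; rewrite !mxE; ring.
apply: le_lt_trans (ler_normD _ _) _; rewrite !normrZ ger0_norm ?subr_ge0// ger0_norm//.
have [->|sn0] := eqVneq s 0; first by rewrite subr0 mul1r mul0r addr0.
have {sn0} s0' : 0 < s by rewrite lt_neqAle eq_sym sn0.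
have -> : e = (1 - s) * e + s * e by ring.
by apply: ler_ltD; [rewrite ler_wpM2l ?subr_ge0 ?(ltW px)|rewrite ltr_pM2l].
Qed.

(** The partial derivatives are bounded near [p] by the constant [c] below, and
    balls are convex, so that the mean value inequality applies along segments.
    The constants are left to filters so that finitely many such bounds can be
    combined. *)
Lemma C1_locally_lipschitz U f p : open U -> U p -> class_C 1 U f ->
  \forall L \near +oo, \forall e \near 0^'+, forall x y,
    `|p - x| < e -> `|p - y| < e -> `|f y - f x| <= L * `|y - x|.
Proof.
move=> openU Up [df cf].
pose c := \sum_i (`|'D_(basis i) f p| + 1).
have c0 : 0 <= c by apply: sumr_ge0 => i _; rewrite addr_ge0.
near=> L.
have : \forall z \near p, U z /\ forall i, `|'D_(basis i) f z| <= c.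
  near=> z; split; first by near: z; exact: open_nbhs_nbhs.
  move=> i; apply: le_trans (_ : `|'D_(basis i) f p| + 1 <= _); last first.
    rewrite /c (bigD1 i)//= lerDl.
    by apply: sumr_ge0 => j _; rewrite addr_ge0.
  move: i; near: z; apply: filter_forall => i.
  by apply: cvgr_norm_le; [exact: (cf (basis i) p Up)|rewrite ltrDl].
move=> /nbhs_normP [e0 /= e00 He0].
near=> e => x y px py.
have xyB (s : R) : 0 <= s <= 1 -> U (x + s *: (y - x)) /\
    forall i, `|'D_(basis i) f (x + s *: (y - x))| <= c.
  move=> s01; apply: He0; rewrite /ball_/=.
  by apply: lt_le_trans (segment_ball px py s01) _; near: e; exact: nbhs_right_le.
have dl (s : R) : 0 <= s <= 1 -> is_derive s 1 (fun s : R => f (x + s *: (y - x)))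
    ('D_(y - x) f (x + s *: (y - x))).
  by move=> /xyB[Us _]; apply: is_derive_line; exact: df.
have := @mean_value_rV R d.+1 (fun s => f (x + s *: (y - x)))
  (fun s => 'D_(y - x) f (x + s *: (y - x))) 0 1 (L * `|y - x|) ler01.
rewrite scale1r scale0r addr0 subrKC subr0 mulr1; apply.
- by rewrite mulr_ge0.
- apply: derivable_within_continuous => s; rewrite in_itv/= => /dl.
  by move=> ?; exact: ex_derive.
- move=> s; rewrite in_itv/= => /andP[/ltW s0 /ltW s1].
  have s01 : 0 <= s <= 1 by rewrite s0.
  split; first exact: dl.
  have [Us cs] := xyB s s01.
  rewrite derive_decomp; last exact: df.
  apply: le_trans (sum_scale_norm_le _ cs) _; rewrite ler_wpM2r//.
Unshelve. all: by end_near. Qed.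

(** The mean value inequality for [f] minus its differential at [z]. Only the
    oscillation of the first derivatives along the segment matters; when they are
    Lipschitz, [c] is proportional to [`|w|] and the remainder is quadratic. *)
Lemma C1_taylor f z w c :
  (forall s, 0 <= s <= 1 -> differentiable f (z + s *: w)) ->
  (forall s i, 0 <= s <= 1 -> `|'D_(basis i) f (z + s *: w) - 'D_(basis i) f z| <= c) ->
  `|f (z + w) - f z - 'D_w f z| <= d.+1%:R * c * `|w|.
Proof.
move=> df Dc.
have c0 : 0 <= c.
  by apply: le_trans (Dc 0 0 _); rewrite ?lexx ?ler01.
pose g s := f (z + s *: w) - s *: 'D_w f z.
have dg (s : R) : 0 <= s <= 1 -> is_derive s 1 g ('D_w f (z + s *: w) - 'D_w f z).
  move=> /df /is_derive_line dfs.
  apply: (is_deriveB dfs).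
  have did : differentiable (@id V) (0 + s *: 'D_w f z) by exact: ex_diff.
  have := is_derive_line did.
  by rewrite derive_id; under eq_fun do rewrite add0r.
have := @mean_value_rV R d.+1 g (fun s => 'D_w f (z + s *: w) - 'D_w f z) 0 1
  (d.+1%:R * c * `|w|) ler01.
rewrite /g !(scale1r, scale0r) addr0 !subr0 mulr1 addrAC; apply.
- by rewrite !mulr_ge0.
- apply: derivable_within_continuous => s; rewrite in_itv/= => /dg.
  by move=> ?; exact: ex_derive.
- move=> s; rewrite in_itv/= => /andP[/ltW s0 /ltW s1].
  have s01 : 0 <= s <= 1 by rewrite s0.
  split; first exact: dg.
  have dfz : differentiable f z by have := df 0; rewrite scale0r addr0; apply; rewrite lexx ler01.
  rewrite derive_decomp ?(derive_decomp w dfz); last exact: df.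
  rewrite -sumrB; under eq_bigr do rewrite -scalerBr.
  by apply: sum_scale_norm_le => i; exact: Dc.
Qed.

End Differential.

(** * Charts of a hypersurface *)

(** All rows of the invertible matrix [A] but the [k]-th span a hyperplane, so
    the vectors orthogonal to them lie on a line, and a line contains just two
    opposite unit vectors. *)
Lemma unit_orthogonal_unique {R : realType} {d : nat} (A B : 'M[R]_d.+1)
    (n n' : 'rV[R]_d.+1) (k : 'I_d.+1) :
  (forall v : 'rV[R]_d.+1, v *m A *m B = v) ->
  (forall i, i != k -> dotr n (row i A) = 0) ->
  (forall i, i != k -> dotr n' (row i A) = 0) ->
  dotr n n = 1 -> dotr n' n' = 1 -> n' = n \/ n' = - n.
Proof.
move=> vAB nA n'A n1 n'1.
have AB1 : A *m B = 1%:M.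
  by apply/row_matrixP => i; rewrite row_mul rowE vAB row1.
have AB1t : A^T *m B^T = 1%:M by rewrite -trmx_mul (mulmx1C AB1) trmx1.
pose b : 'rV[R]_d.+1 := delta_mx 0 k *m B^T.
have spanb (m : 'rV[R]_d.+1) : (forall i, i != k -> dotr m (row i A) = 0) ->
    m = dotr m (row k A) *: b.
  move=> mA; rewrite -{1}(mulmx1 m) -AB1t mulmxA scalemxAl; congr (_ *m _).
  apply/rowP => i; rewrite [RHS]mxE [X in _ = _ * X]mxE eqxx/=.
  have -> : (m *m A^T) 0 i = dotr m (row i A).
    by rewrite mxE; apply: eq_bigr => j _; rewrite !mxE.
  by have [->|ik] := eqVneq i k; rewrite ?mulr1// mA// mulr0.
have nb := spanb _ nA; have n'b := spanb _ n'A.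
set c := dotr n _ in nb; set c' := dotr n' _ in n'b.
move: n1 n'1; rewrite nb n'b !(dotrZl, dotrZr) => c1 c'1.
have : (c' - c) * (c' + c) * dotr b b = 0.
  move: c1 c'1; set x := dotr b b; move=> c1 c'1.
  have -> : (c' - c) * (c' + c) * x = c' * (c' * x) - c * (c * x) by ring.
  by rewrite c1 c'1 subrr.
move=> /eqP; rewrite !mulf_eq0 -orbA => /or3P[/eqP cc|/eqP cc|/eqP b0].
- by left; congr (_ *: _); lra.
- by right; rewrite -scaleNr; congr (_ *: _); lra.
- by move: c1; rewrite b0 !mulr0 => /eqP; rewrite eq_sym oner_eq0.
Qed.

Section Chart.
Context {R : realType} {d : nat}.
Notation V := 'rV[R]_d.+1.
Notation basis i := (delta_mx 0 i : V).
Context (M W Z : set V) (psi phi : V -> V).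
Context (openW : open W) (openZ : open Z).
Context (psiP : forall x, W x -> Z (psi x) /\ phi (psi x) = x).
Context (phiP : forall z, Z z -> W (phi z) /\ psi (phi z) = z).
Context (MP : forall x, W x -> (M x <-> half_hyperplane (psi x))).
Implicit Types (x z w p n : V).

(** The curve is the image under [phi] of the ray from [z] in the direction
    [w]. *)
Lemma chart_tangent z w : Z z -> differentiable phi z ->
  (\forall h \near 0^'+, half_hyperplane (z + h *: w)) ->
  tangent_vector M (phi z) ('D_w phi z).
Proof.
move=> Zz dphi Hzw; exists (fun h => phi (z + h *: w)); split.
- by rewrite scale0r addr0.
- have ZN : \forall h \near 0^'+, Z (h *: w + z).
    by apply: (@cvg_within _ (nbhs (0 : R))); exact: near_line.
  near=> h; have [Wh psih] : W (phi (z + h *: w)) /\ psi (phi (z + h *: w)) = z + h *: w.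
    by apply: phiP; rewrite addrC; near: h.
  by apply/(MP Wh); rewrite psih; near: h.
- rewrite scale0r addr0; under eq_fun do rewrite (addrC z).
  exact: (cvg_dnbhs_at_right (diff_derivable (v := w) dphi)).
Unshelve. all: by end_near. Qed.

Lemma half_hyperplane_segment z z' s : half_hyperplane z -> half_hyperplane z' ->
  0 <= s <= 1 -> half_hyperplane (z + s *: (z' - z)).
Proof.
move=> [zm z0] [z'm z'0] /andP[s0 s1]; split; rewrite !mxE.
  by rewrite zm z'm subrr mulr0 addr0.
have -> : z 0 ord0 + s * (z' 0 ord0 - z 0 ord0) = (1 - s) * z 0 ord0 + s * z' 0 ord0.
  by ring.
by rewrite addr_ge0 ?mulr_ge0 ?subr_ge0.
Qed.

(** In the chart, the segment from [z = psi x] to [z' = psi x'] stays in the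
    convex set [half_hyperplane], so its direction [z' - z] is mapped by the
    differential of [phi] to a tangent vector at [x], orthogonal to [n]. Thus
    [<n, x' - x>] only sees the quadratic remainder of
    [x' - x = phi z' - phi z], and [`|z' - z|] is controlled by [`|x' - x|]
    because [psi] is locally Lipschitz. *)
Lemma chart_reach p : W p -> class_C 1 W psi -> class_C 2 Z phi ->
  exists K, exists2 e, 0 < e & forall x x' n, M x -> M x' ->
    `|p - x| < e -> `|p - x'| < e -> unit_normal M x n ->
    `|dotr n (x' - x)| <= K * dotr (x' - x) (x' - x).
Proof.
move=> Wp C1psi [dphi C1dphi]; have [Zp phip] := psiP Wp.
have [L L0 [e1 e10 [phiL [e2 e20 psiL]]]] : exists2 L, 0 <= L &
    exists2 e1, 0 < e1 & (forall i x y, `|psi p - x| < e1 -> `|psi p - y| < e1 ->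
      `|'D_(basis i) phi y - 'D_(basis i) phi x| <= L * `|y - x|) /\
    exists2 e2, 0 < e2 & (forall x y, `|p - x| < e2 -> `|p - y| < e2 ->
      `|psi y - psi x| <= L * `|y - x|).
  near (+oo_R) => L; exists L => //.
  near ((0 : R)^'+) => e1; exists e1 => //; split.
    near: e1; apply: filter_forall; near: L.
    by apply: filter_forall => i; exact: C1_locally_lipschitz openZ Zp (C1dphi _).
  near ((0 : R)^'+) => e2; exists e2 => //.
  near: e2; near: L.
  exact: C1_locally_lipschitz openW Wp C1psi.
have /nbhs_normP[e3 /= e30 We3] : nbhs p W by exact: open_nbhs_nbhs.
have /nbhs_normP[e4 /= e40 Ze4] : nbhs (psi p) Z by exact: open_nbhs_nbhs.
have /nbhs_normP[e5 /= e50 psie5] :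
    \forall x \near p, `|psi p - psi x| < Num.min e1 e4.
  have cpsi := differentiable_continuous (C1psi.1 p Wp).
  by move/cvgrPdist_lt : cpsi => /(_ (Num.min e1 e4));
    rewrite lt_min e10 e40 => /(_ erefl).
(* the factors are the dimension from the inner product, the constant of the
   quadratic remainder, and the square of the Lipschitz constant of [psi] *)
exists (d.+1%:R * (d.+1%:R * L * L ^+ 2)), (Num.min e2 (Num.min e3 e5)).
  by rewrite !lt_min e20 e30.
move=> x x' n Mx Mx'; rewrite !lt_min.
move=> /andP[px2 /andP[px3 px5]] /andP[px'2 /andP[px'3 px'5]] [n1 ntan].
have [Wx Wx'] : W x /\ W x' by split; apply: We3.
have := psie5 _ px5; have := psie5 _ px'5; rewrite /= !lt_min.
move=> /andP[z'1 z'4] /andP[z1 z4].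
have [Zz phiz] := psiP Wx; have [Zz' phiz'] := psiP Wx'.
set z := psi x in z1 z4 Zz phiz; set z' := psi x' in z'1 z'4 Zz' phiz'.
have Hz : half_hyperplane z by exact/MP.
have Hz' : half_hyperplane z' by exact/MP.
have ntan0 : dotr n ('D_(z' - z) phi z) = 0.
  apply: ntan; rewrite -phiz; apply: chart_tangent => //; first exact: dphi.
  near=> h; apply: half_hyperplane_segment => //; apply/andP; split; near: h.
    exact: nbhs_right_ge.
  exact: nbhs_right_le.
have zz' : `|z' - z| <= L * `|x' - x| by exact: psiL.
have taylor : `|x' - x - 'D_(z' - z) phi z| <= d.+1%:R * (L * `|z' - z|) * `|z' - z|.
  have := @C1_taylor R d phi z (z' - z) (L * `|z' - z|).
  rewrite subrKC phiz' phiz; apply => [s s01|s i s01].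
    by apply: dphi; apply: Ze4; exact: segment_ball.
  apply: le_trans (phiL i _ _ _ _) _ => //; first exact: segment_ball.
  rewrite addrAC subrr add0r normrZ ler_wpM2l//.
  by move: s01 => /andP[s0 s1]; rewrite ger0_norm// ler_piMl.
have -> : dotr n (x' - x) = dotr n (x' - x - 'D_(z' - z) phi z).
  by rewrite [RHS]dotrBr ntan0 subr0.
apply: le_trans (normr_dotr _ _) _; rewrite -[leRHS]mulrA ler_wpM2l//.
apply: le_trans (_ : 1 * (d.+1%:R * (L * `|z' - z|) * `|z' - z|) <= _).
  by rewrite ler_pM// dotr_unit_norm.
rewrite mul1r; apply: le_trans (_ : d.+1%:R * L * (L * `|x' - x|) ^+ 2 <= _).
  by rewrite mulrA -mulrA -expr2 ler_wpM2l ?mulr_ge0// ler_pXn2r// ?nnegrE ?mulr_ge0.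
rewrite exprMn mulrA ler_wpM2l ?norm2_le_dotr//.
by rewrite !mulr_ge0// exprn_ge0.
Unshelve. all: by end_near. Qed.

Lemma chart_differential_cancel z v : Z z -> differentiable phi z ->
  differentiable psi (phi z) -> 'd psi (phi z) ('d phi z v) = v.
Proof.
move=> Zz dphi dpsi.
have near_id : \forall q \near z, (psi \o phi) q = q.
  near=> q; apply: (proj2 (phiP _)); near: q; exact: open_nbhs_nbhs.
have dcomp : differentiable (psi \o phi) z by exact: differentiable_comp.
have dcompv : 'D_v (psi \o phi) z = v.
  by apply: etrans (derive_id z v); exact: near_eq_derive.
apply: etrans dcompv; apply: etrans (esym (deriveE v dcomp)).
by have /(congr1 (@^~ v)) := diff_comp dphi dpsi.
Unshelve. all: by end_near. Qed.

(** At any point of the half-hyperplane, every coordinate direction but the last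
    points into it, so that all rows of the Jacobian of [phi] but the last are
    tangent vectors, including at boundary points; the Jacobian is invertible
    since [psi] is an inverse of [phi]. *)
Lemma chart_unit_normal_unique x n n' : W x -> M x ->
  differentiable psi x -> differentiable phi (psi x) ->
  unit_normal M x n -> unit_normal M x n' -> n' = n \/ n' = - n.
Proof.
move=> Wx Mx dpsi dphi [n1 ntan] [n'1 n'tan].
have [Zz phiz] := psiP Wx; set z := psi x in Zz phiz dphi *.
have [zm z0] : half_hyperplane z by exact/MP.
have row_tangent i : i != ord_max -> tangent_vector M x (row i ('J phi z)).
  move=> im; rewrite rowE -(deriveEjacobian (delta_mx 0 i) dphi) -phiz.
  apply: chart_tangent => //; near=> h; split; rewrite !mxE.
    by rewrite eq_sym (negbTE im) andbF mulr0 addr0.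
  rewrite addr_ge0// mulr_ge0//; near: h; exact: nbhs_right_ge.
apply: (@unit_orthogonal_unique R d ('J phi z) ('J psi x) n n' ord_max) => //.
- move=> v; rewrite -(deriveEjacobian v dphi) -(deriveEjacobian _ dpsi).
  rewrite deriveE// (deriveE v dphi).
  by have := chart_differential_cancel v Zz dphi; rewrite phiz; exact.
- by move=> i /row_tangent; exact: ntan.
- by move=> i /row_tangent; exact: n'tan.
Unshelve. all: by end_near. Qed.

End Chart.

(** * Tubular neighbourhoods *)

Section Tubular.
Context {R : realType} {d : nat}.
Notation V := 'rV[R]_d.+1.
Implicit Types (M : set V) (x y p n : V).

(** Federer's condition for a set to have reach at least [(2 * K)^-1]: it touches
    its tangent spaces to second order, uniformly. *)
Definition reach_bound M (K : R) := forall x x' n, M x -> M x' ->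
  unit_normal M x n -> `|dotr n (x' - x)| <= K * dotr (x' - x) (x' - x).

Lemma dotr_sub_sym x y : dotr (x - y) (x - y) = dotr (y - x) (y - x) :> R.
Proof. by rewrite -opprB -scaleN1r dotrZl dotrZr mulrA mulrNN !mul1r. Qed.

Lemma hypersurface_unit_normal M x n n' : hypersurface (@class_Coo R d.+1) M ->
  M x ->  unit_normal M x n -> unit_normal M x n' -> n' = n \/ n' = - n.
Proof.
move=> hM Mx.
have [W [Z [psi [phi [[openW Wx openZ] [Cpsi Cphi] psiP phiP MP]]]]] := hM x Mx.
apply: (chart_unit_normal_unique openZ psiP phiP MP Wx Mx).
  exact: (Cpsi 1).1.
by apply: (Cphi 1).1; have [] := psiP x Wx.
Qed.

(** By compactness of [M `*` M] it suffices to find a constant near each pair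
    [(p, q)]: charts provide it if [p = q], and otherwise the distance of the two
    points is bounded from below, so that a large multiple of its square
    dominates the left-hand side, which is at most linear in it. *)
Lemma hypersurface_reach M : compact M -> hypersurface (@class_Coo R d.+1) M ->
  \forall K \near +oo, reach_bound M K.
Proof.
move=> cM hM.
have /compact_near_coveringP/near_covering_withinP cMM := compact_setX cM cM.
pose P (K : R) (q : V * V) := forall n, unit_normal M q.1 n ->
  `|dotr n (q.2 - q.1)| <= K * dotr (q.2 - q.1) (q.2 - q.1).
have : \forall K \near +oo, M `*` M `<=` P K.
  apply: cMM => -[p q] [/= Mp Mq].
  have near1 e : 0 < e -> \forall a \near (p, q), `|p - a.1| < e.
    have : (a.1 : V) @[a --> (p, q)] --> p by exact: cvg_fst.
    by move=> /cvgrPdist_lt; apply.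
  have near2 e : 0 < e -> \forall a \near (p, q), `|q - a.2| < e.
    have : (a.2 : V) @[a --> (p, q)] --> q by exact: cvg_snd.
    by move=> /cvgrPdist_lt; apply.
  have [pq|pq] := eqVneq p q.
    rewrite -{}pq in near1 near2 *.
    have [W [Z [psi [phi [[openW Wp openZ] [Cpsi Cphi] psiP phiP MP]]]]] := hM p Mp.
    have [K [e e0 HK]] := chart_reach openW openZ psiP phiP MP Wp (Cpsi 1) (Cphi 2).
    near=> a K' => -[/= M1 M2] n n1.
    apply: le_trans (HK a.1 a.2 n M1 M2 _ _ n1) _.
    - by near: a; exact: near1.
    - by near: a; exact: near2.
    - by rewrite ler_wpM2r ?dotr_ge0//; near: K'; exact: nbhs_pinfty_ge.
  have D0 : 0 < `|p - q| / 4 by rewrite divr_gt0// normr_gt0 subr_eq0.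
  set D := `|p - q| / 4 in D0.
  near=> a K => -[/= M1 M2] n [n1 _].
  have aD : D <= `|a.2 - a.1|.
    have p1 : `|p - a.1| < D by near: a; exact: near1.
    have q2 : `|q - a.2| < D by near: a; exact: near2.
    have : `|p - q| <= `|p - a.1| + (`|a.2 - a.1| + `|q - a.2|).
      have -> : p - q = (p - a.1) - ((a.2 - a.1) + (q - a.2)).
        by apply/rowP => i; rewrite !mxE; ring.
      by apply: le_trans (ler_normB _ _) _; rewrite lerD2l ler_normD.
    have : `|p - q| = 4 * D by rewrite /D; field.
    lra.
  apply: le_trans (normr_dotr _ _) _.
  apply: le_trans (_ : d.+1%:R * `|a.2 - a.1| <= _).
    by rewrite ler_wpM2l// ler_piMl// dotr_unit_norm.
  apply: le_trans (_ : d.+1%:R / D * `|a.2 - a.1| ^+ 2 <= _).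
    by rewrite -mulrA ler_wpM2l// expr2 mulrA ler_peMl// mulrC ler_pdivlMr// mul1r.
  apply: ler_pM; rewrite ?norm2_le_dotr ?sqr_ge0 ?divr_ge0 ?(ltW D0)//.
apply: filterS => K HK x x' n Mx Mx' nx; exact: (HK (x, x')).
Unshelve. all: by end_near. Qed.

(** The feet agree because [x' - x = s n - s' n'] has inner product with itself
    at most [2 * rho * K] times itself; the rest is uniqueness of the unit normal
    up to sign. *)
Lemma reach_normal_expression_unique M K rho y x x' n n' s s' :
  hypersurface (@class_Coo R d.+1) M ->
  reach_bound M K -> 0 <= K -> 2 * rho * K < 1 ->
  normal_expression M rho y x s n -> normal_expression M rho y x' s' n' ->
  x' = x /\ ((s' = s /\ n' = n) \/ (s' = - s /\ n' = - n)).
Proof.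
move=> hM reach K0 rhoK [Mx sr nx yE] [Mx' sr' nx' yE'].
have vE : x' - x = s *: n - s' *: n'.
  by apply/eqP; rewrite subr_eq addrAC eq_sym subr_eq -yE' yE addrC.
have xx' : x' = x.
  apply/eqP; rewrite -subr_eq0; apply/eqP/dotr_eq0.
  have vv : dotr (x' - x) (x' - x) = s * dotr n (x' - x) - s' * dotr n' (x' - x).
    by rewrite {1}vE -scaleNr dotrDl !dotrZl mulNr.
  have b1 := reach x x' n Mx Mx' nx.
  have b2 := reach x' x n' Mx' Mx nx'.
  rewrite dotr_sub_sym// -opprB -scaleN1r dotrZr mulN1r normrN in b2.
  have v0 := dotr_ge0 (x' - x).
  move: vv b1 b2 v0; move: (dotr (x' - x) _) (dotr n _) (dotr n' _) => a b c vv b1 b2 v0.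
  have : a <= 2 * rho * K * a.
    rewrite {1}vv; apply: le_trans (ler_norm _) _; apply: le_trans (ler_normB _ _) _.
    rewrite !normrM.
    have : `|s| * `|b| <= rho * (K * a) by rewrite ler_pM// ltW.
    have : `|s'| * `|c| <= rho * (K * a) by rewrite ler_pM// ltW.
    lra.
  nra.
split=> //; rewrite xx' in nx' vE.
move/eqP: vE; rewrite subrr eq_sym subr_eq0 => /eqP ss'.
have n0 a : a *: n = 0 -> a = 0.
  move=> an; have := congr1 (fun v => dotr v n) an.
  by rewrite dotrZl nx.1 mulr1 -(scale0r 0) dotrZl mul0r.
have [nn'|nn'] := hypersurface_unit_normal hM Mx nx nx'.
  left; split => //; apply/eqP; rewrite -subr_eq0; apply/eqP/n0.
  by rewrite scalerBl ss' nn' subrr.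
right; split => //; apply/eqP; rewrite -subr_eq0 opprK; apply/eqP/n0.
by rewrite scalerDl ss' nn' scalerN subrr.
Qed.

Lemma compact_thickening M (U : set V) : compact M -> (forall p, M p -> nbhs p U) ->
  \forall rho \near 0^'+, forall x y, M x -> `|y - x| < rho -> U y.
Proof.
move=> /compact_near_coveringP cM MU.
suff : \forall rho \near 0^'+, M `<=` (fun x => forall y, `|y - x| < rho -> U y).
  by apply: filterS => rho H x y Mx; exact: H.
apply: cM => p /MU /nbhs_normP[e /= e0 Ue].
have e20 : 0 < e / 2 by rewrite divr_gt0.
near=> x rho.
have re : rho <= e / 2 by near: rho; exact: nbhs_right_le.
move=> y yx; apply: Ue; rewrite /ball_/=.
have -> : p - y = (p - x) - (y - x) by rewrite opprB subrKA.
apply: le_lt_trans (ler_normB _ _) _.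
rewrite (splitr e) ltrD//.
exact: lt_le_trans yx re.
Unshelve. all: by end_near. Qed.

End Tubular.

(** * Positivity near the ridge *)

(* the ambient space is R^(d+1) *)
Theorem theorem4p2 (R : realType) (d : nat) (Omega : set 'rV[R]_d.+1)
    (u : 'rV[R]_d.+1 -> R -> 'rV[R]_d.+1) (t : R) (M : set 'rV[R]_d.+1) (m : R)
    (hOmega : bounded_domain Omega)
    (hu : lipschitz_velocity Omega u)
    (ht : 0 < t)
    (hflow : flow_exists Omega u 0 t)
    (hdiff : forall (tau : R) (x : 'rV[R]_d.+1), 0 <= tau <= t -> Omega x ->
       differentiable (flow Omega u 0 tau) x)
    (hcont : {within Omega, continuous (cg_lambda Omega u 0 t)})
    (hridge : ridge Omega (cg_lambda Omega u 0 t) M)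
    (hsmooth : hypersurface (@class_Coo R d.+1) M)
    (hm : minimum_of [set Num.sqrt (cg_lambda Omega u 0 t x) | x in M] m)
    (hm0 : 0 < m) :
  forall r : R, 1 < r -> r < m ->
  exists2 rho : R, tubular_radius Omega M rho &
    forall y, tubular_neighbourhood M rho y -> 0 < isle Omega u t r y.
Proof.
move=> r r1 rm; have [_ openO _ _] := hOmega; have [MO cM _ _] := hridge.
pose U := [set y | Omega y /\ r < Num.sqrt (cg_lambda Omega u 0 t y)].
have MU p : M p -> nbhs p U.
  move=> Mp; have Op := MO p Mp.
  have cp : {for p, continuous (cg_lambda Omega u 0 t)}.
    by move: hcont; rewrite continuous_open_subspace// => /(_ p); apply; rewrite inE.
  have cs : Num.sqrt (cg_lambda Omega u 0 t y) @[y --> p] -->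
      Num.sqrt (cg_lambda Omega u 0 t p).
    apply: (@continuous_cvg _ _ _ _ _ _ (@Num.sqrt R)) cp; exact: sqrt_continuous.
  near=> y; split; first by near: y; exact: open_nbhs_nbhs.
  near: y; apply: cvgr_gt cs _ _; apply: lt_le_trans rm _.
  by case: hm => _; apply; exists p.
have [K K0 reach] : exists2 K, 0 <= K & reach_bound M K.
  near (+oo_R) => K; exists K => //.
  by near: K; exact: hypersurface_reach.
near ((0 : R)^'+) => rho.
have rho0 : 0 < rho by [].
have rhoK : 2 * rho * K < 1.
  (* [K + 1] since [K] may vanish *)
  have rK : rho < (2 * (K + 1))^-1.
    by near: rho; apply: nbhs_right_lt; rewrite invr_gt0 mulr_gt0// ltr_wpDl.
  rewrite -[ltRHS](@mulVf _ (2 * (K + 1))) ?gt_eqF ?mulr_gt0 ?ltr_wpDl//.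
  apply: le_lt_trans (_ : rho * (2 * (K + 1)) < _); first by nra.
  by rewrite ltr_pM2r// mulr_gt0// ltr_wpDl.
have thick : forall x y, M x -> `|y - x| < rho -> U y.
  by near: rho; exact: compact_thickening.
have exprU y x s n : normal_expression M rho y x s n -> U y.
  move=> [Mx srho [n1 _] ->]; apply: (thick x) => //.
  rewrite addrAC subrr add0r normrZ; apply: le_lt_trans srho.
  by rewrite ler_piMr// dotr_unit_norm.
exists rho.
  split => // y x s n yxsn; split; first by have [] := exprU _ _ _ _ yxsn.
  exists x, s, n; split => // x' s' n'.
  exact: (reach_normal_expression_unique hsmooth reach K0 rhoK yxsn).
move=> y [x [s [n [/exprU [Oy ry] _]]]].
exact: isle_gt0 openO hu (ltW ht) hflow hdiff Oy r1 ry.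
Unshelve. all: by end_near. Qed.
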